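(* For every locally compact group $G$, the quotient group $G/N_{\mathrm{Tr}}(G)$ is almost-SIN.
   Context: For a locally compact group $G$, $\mathrm{T}(G)$ is the set of continuous positive definite functions $u:G\to\mathbb{C}$ with $u(e)=1$ and $u(st)=u(ts)$ for all $s,t\in G$; for $u\in\mathrm{T}(G)$ let $N_u=u^{-1}(\{1\})$, and $N_{\mathrm{Tr}}(G)=\bigcap_{u\in \mathrm{T}(G)}N_u$, a closed normal subgroup of $G$. A locally compact group $H$ with (left) Haar measure $m$ is almost-SIN if there is a net $(U_\alpha)_\alpha$ of (nonempty) relatively compact open subsets of $H$ such that $U_\alpha\searrow\{e\}$, i.e. the net is eventually contained in any given neighbourhood of $e$, and $$\lim_\alpha\ \sup_{t\in K}\frac{m(tU_\alpha t^{-1}\,\triangle\, U_\alpha)}{m(U_\alpha)}=0$$ for each compact $K\subseteq H$. *)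

(* Defs.v *)
From HB Require Import structures.
From mathcomp Require Import all_boot all_order all_algebra generic_quotient.
From mathcomp Require Import complex ring.
From mathcomp Require Import all_classical all_reals all_analysis.

Set Implicit Arguments.
Unset Strict Implicit.
Unset Printing Implicit Defensive.

Import Order.TTheory GRing.Theory Num.Theory.
Import numFieldNormedType.Exports.

Local Open Scope classical_set_scope.
Local Open Scope ring_scope.
Local Open Scope quotient_scope.

HB.mixin Record isTopologicalGroup G of Topological G & Group G := {
  mulg_continuous : continuous (fun x : G * G => (x.1 * x.2)%g);
  invg_continuous : continuous (fun x : G => (x^-1)%g)
}.

(* The base point carries no information: it is only there because the
   measurable types of the library are required to be pointed. *)
#[short(type="topologicalGroupType")]
HB.structure Definition TopologicalGroup :=
  {G of Pointed G & Topological G & Group G & isTopologicalGroup G}.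

Definition locally_compact_group (G : topologicalGroupType) : Prop :=
  hausdorff_space G /\ locally_compact [set: G].

Record normal_subgroup (G : groupType) := NormalSubgroup {
  normal_set :> G -> Prop;
  normal1 : normal_set 1%g;
  normalM : forall x y, normal_set x -> normal_set y -> normal_set (x * y)%g;
  normalV : forall x, normal_set x -> normal_set (x^-1)%g;
  normalJ : forall x g, normal_set x -> normal_set (g^-1 * x * g)%g
}.

Section coset_relation.
Variables (G : groupType) (N : normal_subgroup G).

Definition coset_rel : rel G := fun x y => `[< N (x^-1 * y)%g >].

Lemma coset_rel_refl : reflexive coset_rel.
Proof. by move=> x; apply/asboolP; rewrite mulVg; exact: normal1. Qed.

Lemma coset_rel_sym : symmetric coset_rel.
Proof.
suff H x y : coset_rel x y -> coset_rel y x.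
  by move=> x y; apply/idP/idP; exact: H.
move=> /asboolP /normalV Nxy; apply/asboolP.
by move: Nxy; rewrite invgM invgK.
Qed.

Lemma coset_rel_trans : transitive coset_rel.
Proof.
move=> y x z /asboolP Nxy /asboolP Nyz; apply/asboolP.
by have := normalM Nxy Nyz; rewrite mulgA mulgK.
Qed.

Definition coset_equiv :=
  EquivRel coset_rel coset_rel_refl coset_rel_sym coset_rel_trans.

Definition quotient_group : Type := {eq_quot coset_equiv}.

HB.instance Definition _ := Quotient.on quotient_group.
HB.instance Definition _ := Choice.on quotient_group.

Local Notation pi := (\pi_quotient_group : G -> quotient_group).

Lemma quotient_pi_eq x y : pi x = pi y <-> N (x^-1 * y)%g.
Proof. by split => [/eqmodP/asboolP//|Nxy]; apply/eqmodP/asboolP. Qed.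

Definition quotient_one : quotient_group := pi 1%g.
Definition quotient_inv (a : quotient_group) : quotient_group :=
  pi ((repr a)^-1)%g.
Definition quotient_mul (a b : quotient_group) : quotient_group :=
  pi (repr a * repr b)%g.

Lemma quotient_piM x y : quotient_mul (pi x) (pi y) = pi (x * y)%g.
Proof.
apply/quotient_pi_eq.
have /quotient_pi_eq Nx : pi (repr (pi x)) = pi x by rewrite reprK.
have /quotient_pi_eq Ny : pi (repr (pi y)) = pi y by rewrite reprK.
have := normalM Ny (normalJ y Nx).
by rewrite invgM !mulgA mulgK.
Qed.

Lemma quotient_piV x : quotient_inv (pi x) = pi (x^-1)%g.
Proof.
apply/quotient_pi_eq.
have /quotient_pi_eq/normalV Nx : pi (repr (pi x)) = pi x by rewrite reprK.
have := normalJ (x^-1)%g Nx.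
by rewrite invgM !invgK !mulgA mulgV mul1g.
Qed.

Lemma quotient_ind (P : quotient_group -> Prop) :
  (forall x, P (pi x)) -> forall a, P a.
Proof. by move=> H a; rewrite -[a]reprK; exact: H. Qed.

Lemma quotient_mulA : associative quotient_mul.
Proof.
by elim/quotient_ind => x; elim/quotient_ind => y; elim/quotient_ind => z;
  rewrite !quotient_piM mulgA.
Qed.

Lemma quotient_mul1 : left_id quotient_one quotient_mul.
Proof. by elim/quotient_ind => x; rewrite quotient_piM mul1g. Qed.

Lemma quotient_1mul : right_id quotient_one quotient_mul.
Proof. by elim/quotient_ind => x; rewrite quotient_piM mulg1. Qed.

Lemma quotient_mulV : left_inverse quotient_one quotient_inv quotient_mul.
Proof. by elim/quotient_ind => x; rewrite quotient_piV quotient_piM mulVg. Qed.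

Lemma quotient_Vmul : right_inverse quotient_one quotient_inv quotient_mul.
Proof. by elim/quotient_ind => x; rewrite quotient_piV quotient_piM mulgV. Qed.

HB.instance Definition _ := isGroup.Build quotient_group
  quotient_mulA quotient_mul1 quotient_1mul quotient_mulV quotient_Vmul.
HB.instance Definition _ := isPointed.Build quotient_group 1%g.

Lemma quotient_pi_morphM x y : (pi x * pi y)%g = pi (x * y)%g.
Proof. exact: quotient_piM. Qed.

Lemma quotient_pi_morphV x : ((pi x)^-1)%g = pi (x^-1)%g.
Proof. exact: quotient_piV. Qed.

End coset_relation.

Section quotient_topological_group.
Variables (G : topologicalGroupType) (N : normal_subgroup G).

Local Notation Q := (quotient_group N).
Local Notation pi := (\pi_(quotient_group N) : G -> quotient_group N).

Definition quotient_open (U : set Q) : Prop := open (pi @^-1` U).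

Lemma quotient_openT : quotient_open [set: Q].
Proof. by rewrite /quotient_open preimage_setT; exact: openT. Qed.

Lemma quotient_openI (U V : set Q) :
  quotient_open U -> quotient_open V -> quotient_open (U `&` V).
Proof. exact: openI. Qed.

Lemma quotient_open_bigcup (I : Type) (F : I -> set Q) :
  (forall i, quotient_open (F i)) -> quotient_open (\bigcup_i F i).
Proof. by move=> oF; apply: bigcup_open => i _; exact: oF. Qed.

HB.instance Definition _ := isOpenTopological.Build Q
  quotient_openT quotient_openI quotient_open_bigcup.

Lemma quotient_pi_continuous : continuous pi.
Proof. exact/continuousP. Qed.

Lemma quotient_pi_open (U : set G) : open U -> open (pi @` U).
Proof.
move=> oU; change (open (pi @^-1` (pi @` U))).
have -> : pi @^-1` (pi @` U) =
    \bigcup_(n in [set n | N n]) ((fun x => x * n)%g @^-1` U).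
  apply/seteqP; split => x /=.
    move=> [u Uu /esym /quotient_pi_eq Nxu].
    by exists (x^-1 * u)%g => //=; rewrite mulgA mulgV mul1g.
  move=> [n /= Nn Uxn]; exists (x * n)%g => //.
  apply/esym/quotient_pi_eq.
  by rewrite mulgA mulVg mul1g.
apply: bigcup_open => n _; apply: open_comp => // x _.
apply: (@continuous_comp _ _ _ (fun x => (x, n)) (fun p : G * G => p.1 * p.2)%g).
  by apply: cvg_pair => /=; [exact: cvg_id|exact: cvg_cst].
exact: mulg_continuous.
Qed.

Lemma quotient_pi_nbhs (x : G) (A : set G) : nbhs x A -> nbhs (pi x) (pi @` A).
Proof.
rewrite nbhsE => -[B [oB Bx] BA].
apply: (@filterS _ _ _ (pi @` B)); first exact: image_subset.
by apply: open_nbhs_nbhs; split; [exact: quotient_pi_open|exists x].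
Qed.

Lemma quotient_mulg_continuous : continuous (fun a : Q * Q => (a.1 * a.2)%g).
Proof.
case; elim/quotient_ind => x; elim/quotient_ind => y W /=.
rewrite quotient_pi_morphM => /quotient_pi_continuous.
move=> /(@mulg_continuous G (x, y))[[A B] /= [nA nB] AB].
exists (pi @` A, pi @` B); first by split; exact: quotient_pi_nbhs.
move=> [_ _] /= [[a Aa <-] [b Bb <-]].
by rewrite quotient_pi_morphM; exact: (AB (a, b)).
Qed.

Lemma quotient_invg_continuous : continuous (fun a : Q => (a^-1)%g).
Proof.
elim/quotient_ind => x W /=.
rewrite quotient_pi_morphV => /quotient_pi_continuous.
move=> /(@invg_continuous G x) nW.
apply: filterS (quotient_pi_nbhs nW) => _ [a Wa <-] /=.
by rewrite quotient_pi_morphV.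
Qed.

HB.instance Definition _ := isTopologicalGroup.Build Q
  quotient_mulg_continuous quotient_invg_continuous.

End quotient_topological_group.

Section traces.
Variables (R : realType) (G : topologicalGroupType).
Implicit Types (u : G -> R[i]) (s t : G).

Definition positive_definite u : Prop :=
  forall (n : nat) (s : 'I_n -> G) (c : 'I_n -> R[i]),
    0 <= \sum_(i < n) \sum_(j < n) (c i)^* * c j * u ((s i)^-1 * s j)%g.

(* R[i]^o is R[i] with the topology given by the modulus. *)
Definition tracial u : Prop :=
  [/\ continuous (u : G -> R[i]^o), positive_definite u, u 1%g = 1 &
      forall s t, u (s * t)%g = u (t * s)%g].

Lemma positive_definite_conj u s : positive_definite u -> u 1%g = 1 ->
  u (s^-1)%g = (u s)^*.
Proof.
move=> up u1.
have H (z : R[i]) : z^* * z = 1 ->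
    (z * u s + z^* * u (s^-1)%g)^* = z * u s + z^* * u (s^-1)%g.
  move=> zz; apply/CrealP.
  have := up 2%N (fun i => nth 1%g [:: 1%g; s] i) (fun i => nth 0 [:: 1; z] i).
  rewrite !big_ord_recl !big_ord0 /= invg1 !mul1g mulVg mulg1 u1 rmorph1.
  rewrite !addr0 !mul1r !mulr1 zz => /ger0_real.
  set w := z * u s + _.
  rewrite (_ : _ + _ = w + 2%:R); last by rewrite /w; ring.
  by move=> wr; rewrite -(addrK 2%:R w) rpredB// realn.
have cD (x y : R[i]) : (x + y)^* = x^* + y^* by exact: rmorphD.
have cM (x y : R[i]) : (x * y)^* = x^* * y^* by exact: rmorphM.
have cN (x : R[i]) : (- x)^* = - x^* by exact: rmorphN.
have := H 1; rewrite rmorph1 !mul1r => /(_ erefl).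
have := H 'i; rewrite conjCi mulNr -expr2 sqrCi opprK => /(_ erefl).
rewrite !cD !cM cN conjCi opprK.
set a := u s; set b := u _ => E1 E2.
have {}E1 : b^* - a^* = a - b.
  apply: (mulfI (neq0Ci (R[i]))); rewrite !mulrBr addrC -mulNr E1.
  by rewrite mulNr.
have : 2%:R * a = 2%:R * b^*.
  transitivity ((a + b) + (a - b)); first by ring.
  by rewrite -E1 -E2; ring.
by move=> /mulfI -> //; rewrite ?conjCK // pnatr_eq0.
Qed.

Lemma tracial_mul u s t : tracial u -> u s = 1 -> u (s * t)%g = u t.
Proof.
move=> [_ up u1 _] us.
have conj_u x := positive_definite_conj x up u1.
suff H x : u (s^-1 * x)%g = u x by rewrite -H mulgA mulVg mul1g.
set d := u (s^-1 * x)%g - u x.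
have := up 3%N (fun i => nth 1%g [:: s; 1%g; x] i)
               (fun i => nth 0 [:: 1; -1; - d^*] i).
rewrite !big_ord_recl !big_ord0 /=.
rewrite invg1 !mul1g !mulVg !mulg1 u1 (conj_u s) us.
have c1 : 1^* = 1 :> R[i] by exact: rmorph1.
have cN (y : R[i]) : (- y)^* = - y^* by exact: rmorphN.
have cB (y z : R[i]) : (y - z)^* = y^* - z^* by exact: rmorphB.
have -> : u (x^-1 * s)%g = (u (s^-1 * x)%g)^* by rewrite -conj_u invgM invgK.
rewrite (conj_u x) !cN !c1 conjCK.
set e := (X in 0 <= X).
have -> : e = - (d * d^*).
  by rewrite /e /d cB; ring.
rewrite oppr_ge0 => le0.
have /eqP : d * d^* = 0 by apply/le_anti; rewrite le0 mul_conjC_ge0.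
by rewrite mul_conjC_eq0 subr_eq0 => /eqP.
Qed.

Definition NTr_set : set G :=
  \bigcap_(u in [set u | tracial u]) (u @^-1` [set 1]).

Lemma NTr1 : NTr_set 1%g.
Proof. by move=> u []. Qed.

Lemma NTrM s t : NTr_set s -> NTr_set t -> NTr_set (s * t)%g.
Proof.
by move=> Ns Nt u Tu /=; rewrite (tracial_mul _ Tu (Ns _ Tu)); exact: Nt.
Qed.

Lemma NTrV s : NTr_set s -> NTr_set (s^-1)%g.
Proof.
by move=> Ns u Tu /=; have [_ _ u1 _] := Tu;
  rewrite -(tracial_mul _ Tu (Ns _ Tu)) mulgV.
Qed.

Lemma NTrJ s t : NTr_set s -> NTr_set (t^-1 * s * t)%g.
Proof.
move=> Ns u Tu /=; have [_ _ _ uC] := Tu.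
by rewrite uC mulgA mulgV mul1g; exact: Ns.
Qed.

Definition NTr : normal_subgroup G := NormalSubgroup NTr1 NTrM NTrV NTrJ.

End traces.

Section almost_SIN.
Variables (R : realType) (H : topologicalGroupType).

Definition borel : Type := g_sigma_algebraType (@open H).

HB.instance Definition _ := Measurable.on borel.

Implicit Types (A U K V : set H).

(* Haar measures are Radon: finite on compact sets, outer regular on Borel sets
   and inner regular on open sets. *)
Definition left_haar (mu : {measure set borel -> \bar R}) : Prop :=
  [/\ mu [set: H] != 0%E,
      (forall (x : H) A, measurable (A : set borel) ->
         mu [set (x * a)%g | a in A] = mu A),
      (forall K, compact K -> (mu K < +oo)%E),
      (forall A, measurable (A : set borel) ->
         mu A = ereal_inf
           [set mu U | U in [set U : set H | open U /\ A `<=` U]]) &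
      (forall U, open U ->
         mu U = ereal_sup
           [set mu K | K in [set K : set H | compact K /\ K `<=` U]])].

Definition directed (I : Type) (le : I -> I -> Prop) : Prop :=
  [/\ inhabited I, (forall a, le a a),
      (forall a b c, le a b -> le b c -> le a c) &
      (forall a b, exists c, le a c /\ le b c)].

Definition eventually_net (I : Type) (le : I -> I -> Prop) : set_system I :=
  [set P | exists a, forall b, le a b -> P b].

(* The supremum is over values in [0, +oo], hence is 0 when K is empty,
   whereas ereal_sup set0 = -oo. *)
Definition conj_defect (mu : {measure set borel -> \bar R}) K U : \bar R :=
  ereal_sup ([set 0%E] `|`
    [set (mu ([set (t * x * t^-1)%g | x in U] `+` U) * (mu U)^-1)%E | t in K]).

Definition almost_SIN : Prop :=
  locally_compact_group H /\
  forall mu : {measure set borel -> \bar R}, left_haar mu ->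
    exists (I : Type) (le : I -> I -> Prop) (U : I -> set H),
      [/\ directed le,
          (forall a, [/\ open (U a), U a !=set0 & precompact (U a)]),
          (forall V, nbhs (1%g : H) V ->
             \forall a \near eventually_net le, U a `<=` V) &
          (forall K, compact K ->
             conj_defect mu K (U a) @[a --> eventually_net le] --> 0%E)].

End almost_SIN.

(* Main.v *)
Require Import Defs.
From mathcomp Require Import all_boot all_order all_algebra.
From mathcomp Require Import generic_quotient complex.
From mathcomp Require Import all_classical all_reals all_analysis.

(** Write Q for the quotient of G by the common level set N of its traces. Every
    trace u satisfies u (s * n) = u s for n in N, so it descends to a continuous
    class function on Q, and by the choice of N these functions separate the
    identity of Q from its other points ([NTr_separate]). Separation makes Q
    Hausdorff ([separating_hausdorff]), and Q is locally compact because the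
    projection is continuous and open.

    The sets required of an almost-SIN group can then be taken exactly invariant
    under any prescribed compact set K of conjugations, so the defect in the
    limit vanishes identically once the index is large
    ([conj_stable_nbhs1]). To see this, let O be a small relatively compact open
    neighbourhood of the identity and C the union of K and its inverse. The
    conjugates of O by C stay in a compact set, and the part L of that compact
    set lying outside O misses the identity. By compactness of L, finitely many
    class functions already tell all of L from the identity, hence some open W
    containing the identity, invariant under every conjugation, is disjoint from
    L ([compact_avoids_invariant_nbhs1]). Now if x is in O and in W and t is in
    C, the conjugate of x by t is in W, so outside L, so in O. Thus the
    intersection of O and W is carried into itself by C, and being invariant
    under both t and its inverse it is carried onto itself by each t in K. *)

Set Implicit Arguments.
Unset Strict Implicit.
Unset Printing Implicit Defensive.

Import numFieldNormedType.Exports.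

Local Open Scope classical_set_scope.
Local Open Scope ring_scope.
Local Open Scope quotient_scope.

Lemma mulg_continuousl (H : topologicalGroupType) (a : H) :
  continuous (fun x : H => (a * x)%g).
Proof.
move=> x.
apply: (@continuous_comp _ _ _ (fun x => (a, x)) (fun p : H * H => p.1 * p.2)%g).
  by apply: cvg_pair => /=; [exact: cvg_cst|exact: cvg_id].
exact: mulg_continuous.
Qed.

Lemma conjg_continuous (H : topologicalGroupType) :
  continuous (fun p : H * H => (p.1 * p.2 * p.1^-1)%g).
Proof.
move=> p.
apply: (@continuous_comp _ _ _ (fun p : H * H => (p.1 * p.2, p.1^-1)%g)
  (fun p : H * H => p.1 * p.2)%g); last exact: mulg_continuous.
apply: cvg_pair => /=; first exact: mulg_continuous.
apply: (@continuous_comp _ _ _ fst (fun x : H => x^-1)%g); first exact: cvg_fst.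
exact: invg_continuous.
Qed.

Section class_functions.
Variables (H : topologicalGroupType) (S : topologicalType).

Definition class_functions_separate : Prop :=
  forall s : H, s <> 1%g -> exists f : H -> S,
    [/\ continuous f, (forall x y, f (x * y)%g = f (y * x)%g) & f s <> f 1%g].

Definition conj_invariant (W : set H) : Prop :=
  forall t x, W x -> W (t * x * t^-1)%g.

(** This filter is in general strictly coarser than the neighbourhoods of 1:
    equality is the SIN property. *)
Definition invariant_nbhs1 : set_system H :=
  [set A | exists W, [/\ open W, W 1%g, conj_invariant W & W `<=` A]].

#[local] Instance invariant_nbhs1_filter : Filter invariant_nbhs1.
Proof.
split.
- by exists setT; split => //; exact: openT.
- move=> A B [V [oV V1 iV VA]] [W [oW W1 iW WB]]; exists (V `&` W); split.
  + exact: openI.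
  + by [].
  + by move=> t x [Vx Wx]; split; [exact: iV|exact: iW].
  + exact: setISS.
- move=> A B AB [W [oW W1 iW WA]]; exists W; split => //.
  exact: subset_trans AB.
Qed.

Hypothesis hausS : hausdorff_space S.
Hypothesis sepH : class_functions_separate.

(** Separating 1 from the other points is enough, as left translates of the
    separating functions then separate any two points. *)
Lemma separating_hausdorff : hausdorff_space H.
Proof.
move=> x y xy; apply: contrapT => nxy.
have [|f [fc _ fxy]] := @sepH (x^-1 * y)%g.
  by move=> /(congr1 (fun z => x * z)%g); rewrite mulgA mulgV mul1g mulg1 => /esym.
apply: fxy; rewrite -(mulVg x).
pose g z := f (x^-1 * z)%g.
have gc : continuous g.
  move=> z; apply: (@continuous_comp _ _ _ (fun z => (x^-1 * z)%g) f).
    exact: mulg_continuousl.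
  exact: fc.
apply/esym/hausS => A B gA gB.
have [z [Az Bz]] := xy (g @^-1` A) (g @^-1` B) (gc x A gA) (gc y B gB).
by exists (g z).
Qed.

(** Preimages of open sets under class functions are conjugation invariant, so
    each point of L has a neighbourhood missing some invariant neighbourhood of
    1; the near-covering form of compactness turns this into one invariant
    neighbourhood missing all of L. *)
Lemma compact_avoids_invariant_nbhs1 (L : set H) :
  compact L -> ~ L 1%g -> invariant_nbhs1 (~` L).
Proof.
move=> /compact_near_coveringP cL nL1.
suff : \forall w \near invariant_nbhs1, L `<=` (fun x => w <> x).
  by apply: filterS => w Lw /Lw.
apply: cL => x Lx.
have [|f [fc fC fx]] := @sepH x; first by move=> x1; apply: nL1; rewrite -x1.
move: hausS; rewrite open_hausdorff => /(_ (f x) (f 1%g)) [|[A B]/=].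
  exact/eqP.
rewrite !inE => -[Ax B1] [oA oB AB0].
exists (f @^-1` A, f @^-1` B) => /=.
  split; first by apply: fc; exact: open_nbhs_nbhs.
  exists (f @^-1` B); split => //.
    by apply: open_comp => // z _; exact: fc.
  by move=> t z; rewrite /= fC mulgA mulVg mul1g.
move=> [y w] /= [Ay Bw] wy; rewrite wy in Bw.
by move: (conj Ay Bw : (A `&` B) (f y)); rewrite (AB0 : _ = set0).
Qed.

Hypothesis lcH : locally_compact [set: H].

(** The substitute for SIN: small neighbourhoods of 1 that are invariant, not
    under all conjugations, but under those by a given compact set. *)
Lemma conj_stable_nbhs1 (K V : set H) : compact K -> nbhs 1%g V ->
  exists U, [/\ open U, U 1%g, precompact U, U `<=` V &
    forall t, K t -> [set (t * x * t^-1)%g | x in U] = U].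
Proof.
move=> cK nV.
have := @lcH 1%g I; rewrite withinET => -[B nB [cB clB]].
pose O := (V `&` B)°.
have oO : open O by exact: open_interior.
have O1 : O 1%g by exact: filterI.
have OVB : O `<=` V `&` B by exact: interior_subset.
have pO : precompact O.
  by exists B => // x /OVB[].
pose C := K `|` (fun x => x^-1)%g @` K.
have cC : compact C.
  apply: compactU => //; apply: continuous_compact => //.
  exact/continuous_subspaceT/invg_continuous.
(* The points to which conjugation by C may throw an element of O out of O. *)
pose L := (fun p : H * H => (p.1 * p.2 * p.1^-1)%g) @` (C `*` closure O) `&` ~` O.
have cL : compact L.
  apply: compact_closedI; last exact: open_closedC.
  apply: continuous_compact; first exact/continuous_subspaceT/conjg_continuous.
  by apply: compact_setX => //; rewrite -precompactE.
have [|W [oW W1 iW WL]] := compact_avoids_invariant_nbhs1 cL; first by case.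
have stable t x : C t -> (O `&` W) x -> (O `&` W) (t * x * t^-1)%g.
  move=> Ct [Ox Wx]; have Wtx := iW t x Wx; split => //.
  apply: contrapT => nO; apply: (WL _ Wtx); split => //.
  by exists (t, x) => //; split => //; exact: subset_closure.
exists (O `&` W); split => //.
- exact: openI.
- by apply: precompact_subset pO => x [].
- by move=> x [/OVB[]].
- move=> t Kt; apply/seteqP; split => [_ [x Ux <-]|x Ux].
    by apply: stable => //; left.
  (* Stability under t^-1 gives surjectivity of the conjugation by t. *)
  exists (t^-1 * x * t)%g; last by rewrite !mulgA mulgV mul1g mulgK.
  by rewrite -{2}(invgK t); apply: stable => //; right; exists t.
Qed.

(** The net is indexed by pairs of a compact set K and a neighbourhood V of 1,
    larger K and smaller V coming later. The set attached to (K, V)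
    equals its conjugates by elements of K, so its defect over K or any smaller
    compact set is 0. *)
Lemma class_functions_separate_almost_SIN (R : realType) : almost_SIN R H.
Proof.
split; first by split; [exact: separating_hausdorff|].
move=> mu _.
pose I := {p : set H * set H | compact p.1 /\ nbhs 1%g p.2}.
pose le (a b : I) :=
  (sval a).1 `<=` (sval b).1 /\ (sval b).2 `<=` (sval a).2.
have mkI (K V : set H) (cK : compact K) (nV : nbhs 1%g V) :
  {a : I | sval a = (K, V)} by exists (exist _ (K, V) (conj cK nV)).
have /choice[U UP] (a : I) := conj_stable_nbhs1 (proj1 (svalP a)) (proj2 (svalP a)).
have nT : nbhs (1%g : H) setT by exact: filterT.
exists I, le, U; split.
- split.
  + by constructor; exact: sval (mkI _ _ compact0 nT).
  + by move=> a; split.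
  + by move=> a b c [? ?] [? ?]; split; apply: subset_trans; eassumption.
  + move=> a b; have [[cKa nVa] [cKb nVb]] := (svalP a, svalP b).
    have [c ce] := mkI _ _ (compactU cKa cKb) (filterI nVa nVb).
    exists c; rewrite /le ce; split; split => /= x.
    * by left.
    * by case.
    * by right.
    * by case.
- by move=> a; have [oU U1 pU _ _] := UP a; split => //; exists 1%g.
- move=> V nV; have [a ae] := mkI _ _ compact0 nV.
  exists a => b [_]; rewrite ae /= => bV.
  by have [_ _ _ UV _] := UP b; exact: subset_trans bV.
- move=> K cK A nA; have [a ae] := mkI _ _ cK nT.
  exists a => b [+ _]; rewrite ae /= => Kb.
  have [_ _ _ _ Ub] := UP b.
  suff -> : conj_defect mu K (U b) = 0%E by exact: nbhs_singleton.
  rewrite /conj_defect (_ : _ `|` _ = [set 0%E]) ?ereal_sup1//.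
  apply/seteqP; split => [x [//|[t /Kb Kt <-]]|x ->]; last by left.
  by rewrite /= Ub// setYK measure0 mul0e.
Qed.

End class_functions.

Lemma quotient_locally_compact (G : topologicalGroupType)
    (N : normal_subgroup G) :
  locally_compact [set: G] ->
  hausdorff_space (quotient_group N) -> locally_compact [set: quotient_group N].
Proof.
move=> lcG hQ + _; elim/quotient_ind => x.
have := @lcG x I; rewrite !withinET => -[B nB [cB _]].
exists (\pi_(quotient_group N) @` B); first exact: quotient_pi_nbhs.
have cpB : compact (\pi_(quotient_group N) @` B).
  apply: continuous_compact cB.
  exact/continuous_subspaceT/quotient_pi_continuous.
by split => //; exact: compact_closed.
Qed.

Section trace_quotient.
Variables (R : realType) (G : topologicalGroupType).

Local Notation Q := (quotient_group (NTr R G)).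
Local Notation pi := (\pi_Q : G -> Q).

(** A trace is constant on the cosets of the kernel, so evaluating it at the
    representative of a coset defines the descended class function. *)
Lemma NTr_separate : @class_functions_separate Q R[i]^o.
Proof.
elim/quotient_ind => s ns1.
have [u [Tu us]] : exists u : G -> R[i], tracial u /\ u s <> 1.
  apply: contrapT => nu; apply: ns1; apply/esym/quotient_pi_eq.
  rewrite invg1 mul1g => u Tu /=.
  by apply: contrapT => us; apply: nu; exists u.
have [uc _ u1 uC] := Tu.
have uE x : u (repr (pi x)) = u x.
  have /quotient_pi_eq Nx : pi (repr (pi x)) = pi x by rewrite reprK.
  by rewrite -(tracial_mul _ Tu (Nx _ Tu)) uC mulgA mulgV mul1g.
exists (fun a => u (repr a)); split.
- apply/continuousP => A oA.
  change (open (pi @^-1` ((fun a => u (repr a)) @^-1` A))).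
  have -> : pi @^-1` ((fun a => u (repr a)) @^-1` A) = u @^-1` A.
    by apply/funext => x; rewrite /preimage /= uE.
  by move/continuousP: uc; apply.
- elim/quotient_ind => x; elim/quotient_ind => y.
  by rewrite !quotient_pi_morphM !uE.
- by rewrite !uE u1.
Qed.

End trace_quotient.

Theorem proposition2p9 (R : realType) (G : topologicalGroupType)
  (lcG : locally_compact_group G) : almost_SIN R (quotient_group (NTr R G)).
Proof.
have [_ lc] := lcG.
have hausC : hausdorff_space R[i]^o by exact: norm_hausdorff.
apply: (@class_functions_separate_almost_SIN _ _ hausC).
  exact: NTr_separate.
apply: quotient_locally_compact lc _.
exact: separating_hausdorff hausC (@NTr_separate R G).
Qed.
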